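(* Suppose that $A$ is a central type. Then $A$ admits a unique H-space structure, i.e. the type $\mathrm{HSpace}(A)$ is contractible. In addition, $A$ is connected, so this H-space structure is both left- and right-invertible.
   Context: We work in homotopy type theory with a univalent universe. Base points are written $\mathrm{pt}$. For $t : T$, $T_{(t)} := \sum_{t':T}(|t'|_0 = |t|_0)$. A pointed type $A$ is central if the evaluation map $f \mapsto f(\mathrm{pt}) : (A \to A)_{(\mathrm{id})} \to A$ is an equivalence. A (coherent) H-space structure on a pointed type $A$ consists of an operation $\mu : A \to A \to A$, unit laws $\mu_l : \mu(\mathrm{pt},-) = \mathrm{id}_A$ and $\mu_r : \mu(-,\mathrm{pt}) = \mathrm{id}_A$, and a coherence $\mu_l(\mathrm{pt}) = \mu_r(\mathrm{pt})$; $\mathrm{HSpace}(A)$ is the type of these. It is left-invertible (right-invertible) if $\mu(a,-)$ (respectively $\mu(-,a)$) is an equivalence $A \to A$ for all $a:A$. *)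

(* Defs.v *)
(** Homotopy type theory is rendered in the two-level style: Rocq is the outer
    level, and its equality [=] plays the role of judgmental equality.  The
    types of homotopy type theory are the Rocq types that carry a fibrancy
    structure [Fib].  They have an identity type [Id] of their own, which
    eliminates only into fibrant types.

    Rocq's inductive equality cannot serve as the identity type: it lives in
    the impredicative sort [Prop] and is compatible with proof irrelevance, so
    a univalence hypothesis about it would be degenerate or contradictory.

    The outer level has to stay constructive: products consist of all Rocq
    functions, so excluded middle for [=] would force every [Id] to be trivial. *)

Set Implicit Arguments.
Unset Strict Implicit.

Record fibrant (Fib : Type -> Type) := Fibrant { el :> Type; fib : Fib el }.

(** Dependent products and sums are Rocq's own, so that they compute. *)
Record type_theory := TypeTheory {
  Fib : Type -> Type;
  fib_pi : forall (A : fibrant Fib) (B : A -> fibrant Fib),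
    Fib (forall x : A, B x);
  fib_sigma : forall (A : fibrant Fib) (B : A -> fibrant Fib),
    Fib {x : A & B x};
  Id : forall A : fibrant Fib, A -> A -> fibrant Fib;
  rfl : forall (A : fibrant Fib) (x : A), Id x x;
  J : forall (A : fibrant Fib) (x : A) (P : forall y : A, Id x y -> fibrant Fib),
    P x (rfl x) -> forall (y : A) (p : Id x y), P y p;
  J_rfl : forall (A : fibrant Fib) (x : A)
    (P : forall y : A, Id x y -> fibrant Fib) (d : P x (rfl x)),
    J d (rfl x) = d
}.

Arguments Id {t} A x y : rename.
Arguments rfl {t A} x : rename.
Arguments J {t A x} P d {y} p : rename.
Arguments J_rfl {t A x} P d : rename.

Definition type (T : type_theory) := fibrant (Fib T).

Section Basics.
Context {T : type_theory}.
Implicit Types A B : type T.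

Definition Pi A (B : A -> type T) : type T := Fibrant (fib_pi B).
Definition Sigma A (B : A -> type T) : type T := Fibrant (fib_sigma B).
Definition Arr A B : type T := Pi (fun _ : A => B).

Definition happly A B (f g : Arr A B) (p : Id (Arr A B) f g) (x : A) :
    Id B (f x) (g x) :=
  J (fun (h : Arr A B) _ => Id B (f x) (h x)) (rfl (f x)) p.

Definition isContr A : type T := Sigma (fun x : A => Pi (fun y : A => Id A x y)).
Definition isProp A : type T := Pi (fun x : A => Pi (fun y : A => Id A x y)).
Definition isSet A : type T :=
  Pi (fun x : A => Pi (fun y : A => isProp (Id A x y))).

Definition fiber A B (f : Arr A B) (y : B) : type T :=
  Sigma (fun x : A => Id B (f x) y).
Definition isEquiv A B (f : Arr A B) : type T :=
  Pi (fun y : B => isContr (fiber f y)).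
Definition Equiv A B : type T := Sigma (fun f : Arr A B => isEquiv f).

Definition idmap A : Arr A A := fun x => x.
Arguments idmap : clear implicits.

Lemma isEquiv_idmap A : isEquiv (idmap A).
Proof.
intro y. exists (existT _ y (rfl y)). intros [x p].
exact (J (fun y (p : Id A x y) =>
            Id (fiber (idmap A) y) (existT _ y (rfl y)) (existT _ x p))
         (rfl _) p).
Defined.
Arguments isEquiv_idmap : clear implicits.

Definition equiv_idmap A : Equiv A A := existT _ (idmap A) (isEquiv_idmap A).
End Basics.

Arguments idmap {T} A.
Arguments isEquiv_idmap {T} A.

(** The computation rule on points is judgmental, and elimination is into
    arbitrary families of sets, including large ones. *)
Record set_truncation (T : type_theory) := SetTruncation {
  Trunc0 : type T -> type T;
  tr0 : forall A : type T, A -> Trunc0 A;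
  isSet_Trunc0 : forall A : type T, isSet (Trunc0 A);
  Trunc0_ind : forall (A : type T) (P : Trunc0 A -> type T),
    (forall t, isSet (P t)) -> (forall a, P (tr0 a)) -> forall t, P t;
  Trunc0_ind_tr0 : forall (A : type T) (P : Trunc0 A -> type T)
    (s : forall t, isSet (P t)) (d : forall a, P (tr0 a)) (a : A),
    Trunc0_ind s d (tr0 a) = d a
}.

Definition idtoequiv (T : type_theory) (U : type T) (El : U -> type T)
    (a b : U) (p : Id U a b) : Equiv (El a) (El b) :=
  J (fun c _ => Equiv (El a) (El c)) (equiv_idmap (El a)) p.

Record univalent_universe (T : type_theory) (S : set_truncation T) := Universe {
  U : type T;
  El : U -> type T;
  u_pi : forall a : U, (El a -> U) -> U;
  El_pi : forall (a : U) (b : El a -> U), El (u_pi b) = Pi (fun x => El (b x));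
  u_sigma : forall a : U, (El a -> U) -> U;
  El_sigma : forall (a : U) (b : El a -> U),
    El (u_sigma b) = Sigma (fun x => El (b x));
  u_Id : forall a : U, El a -> El a -> U;
  El_Id : forall (a : U) (x y : El a), El (u_Id x y) = Id (El a) x y;
  u_Trunc0 : U -> U;
  El_Trunc0 : forall a : U, El (u_Trunc0 a) = Trunc0 S (El a);
  univalence : forall a b : U,
    isEquiv (fun p : Id U a b => idtoequiv El p : Equiv (El a) (El b))
}.

Record pointed (T : type_theory) (S : set_truncation T)
    (V : univalent_universe S) := Pointed {
  carrier : U V;
  pt : El carrier
}.

(** The component [X_(x)] of [X] at [x]. *)
Definition component (T : type_theory) (S : set_truncation T) (X : type T)
    (x : X) : type T :=
  Sigma (fun x' : X => Id (Trunc0 S X) (tr0 S x') (tr0 S x)).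

Definition connected (T : type_theory) (S : set_truncation T) (X : type T) :
    type T :=
  isContr (Trunc0 S X).

Definition pointed_type (T : type_theory) (S : set_truncation T)
    (V : univalent_universe S) (A : pointed V) : fibrant (Fib T) :=
  El (carrier A).
Coercion pointed_type : pointed >-> fibrant.

Section Central.
Context {T : type_theory} {S : set_truncation T} {V : univalent_universe S}.

Implicit Types A : pointed V.

Definition ev A : Arr (component S (X := Arr A A) (idmap A)) A :=
  fun f => projT1 f (pt A).

Definition central A : type T := isEquiv (ev (A := A)).

Definition HSpace A : type T :=
  Sigma (fun mu : Arr A (Arr A A) =>
  Sigma (fun mul : Id (Arr A A) (mu (pt A)) (idmap A) =>
  Sigma (fun mur : Id (Arr A A) (fun a => mu a (pt A)) (idmap A) =>
    Id (Id A (mu (pt A) (pt A)) (pt A)) (happly mul (pt A)) (happly mur (pt A))))).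

Definition op A (m : HSpace A) : A -> A -> A := projT1 m.

Definition left_invertible A (m : HSpace A) : type T :=
  Pi (fun a : A => isEquiv (fun x : A => op m a x : A)).
Definition right_invertible A (m : HSpace A) : type T :=
  Pi (fun a : A => isEquiv (fun x : A => op m x a : A)).
End Central.

(* Main.v *)
Require Import Defs.

(** Throughout, [ev] is evaluation at the base point, from the component of the
    identity to [A]; centrality says that it is an equivalence.

    Connectedness.  The component of a point is always connected, and [ev]
    exhibits [A] as a retract of such a component.

    Uniqueness.  Since [A] is connected, every [mu a] of an H-space lies in the
    component of [mu pt], hence of the identity.  So [mu] with its right unit law
    is a section of [ev], and sections of an equivalence form a contractible
    type.  Over a given section, the left unit law together with the coherence
    is a path [mu pt = id] with a prescribed value at the base point.  These
    form a contractible type as well ([central_isContr_fiber_ap_ev]), because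
    [ev] is an embedding.

    Invertibility.  Swapping the arguments of an H-space structure gives another
    one, so uniqueness makes the operation commutative.  If [mu a b = pt], then
    [mu a o mu b] and [mu b o mu a] lie in the component of the identity and fix
    the base point, so both are the identity.  Hence the existence of such a [b]
    is a proposition, it holds for [a = pt], and by connectedness it holds for
    all [a].  Right invertibility is left invertibility of the swapped
    structure.

    Univalence enters in two places.  Postcomposition with an equivalence is an equivalence
    ([isEquiv_postcomp]); this gives the contractible type of sections.  And
    the propositions of the universe form a set, so that a family of
    propositions descends along the set truncation and can be proved on a
    connected type at one point ([connected_ind]).  The equations that decode
    the type formers of the universe hold for the outer equality, and without
    outer function extensionality they cannot be rewritten under binders.
    Therefore families are kept in the coded form [fun x => El (b x)], and
    they are compared with the intended ones pointwise, inside retractions in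
    which the change of form cancels. *)

Set Implicit Arguments.
Unset Strict Implicit.

(** * Paths, contractibility and equivalences *)

Section Paths.
Context {T : type_theory}.
Implicit Types A B X Y : type T.

Definition inv A (x y : A) (p : Id A x y) : Id A y x :=
  J (fun y _ => Id A y x) (rfl x) p.

Definition concat A (x y z : A) (p : Id A x y) (q : Id A y z) : Id A x z :=
  J (fun z _ => Id A x z) p q.

Definition ap A B (f : A -> B) (x y : A) (p : Id A x y) : Id B (f x) (f y) :=
  J (fun y _ => Id B (f x) (f y)) (rfl (f x)) p.

Definition transport A (B : A -> type T) (x y : A) (p : Id A x y) (b : B x) :
    B y :=
  J (fun y _ => B y) b p.

Lemma id_of_eq A (x y : A) : x = y -> Id A x y.
Proof. intros []. exact (rfl x). Defined.

Lemma inv_rfl A (x : A) : inv (rfl x) = rfl x.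
Proof. exact (J_rfl (fun y _ => Id A y x) (rfl x)). Qed.

Lemma ap_rfl A B (f : A -> B) (x : A) : ap f (rfl x) = rfl (f x).
Proof. exact (J_rfl (fun y _ => Id B (f x) (f y)) (rfl (f x))). Qed.

Lemma transport_rfl A (B : A -> type T) (x : A) (b : B x) :
  transport (rfl x) b = b.
Proof. exact (J_rfl (fun y _ => B y) b). Qed.

Lemma concat_rfl A (x y : A) (p : Id A x y) : concat p (rfl y) = p.
Proof. exact (J_rfl (fun z _ => Id A x z) p). Qed.

Lemma concat_inv_l A (x y : A) (p : Id A x y) :
  Id (Id A y y) (concat (inv p) p) (rfl y).
Proof.
refine (J (fun y p => Id (Id A y y) (concat (inv p) p) (rfl y)) _ p).
apply id_of_eq. rewrite concat_rfl. apply inv_rfl.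
Qed.

Lemma concat_inv_cancel A (x y z : A) (p : Id A x y) (q : Id A x z) :
  Id (Id A x z) (concat p (concat (inv p) q)) q.
Proof.
refine (J (fun z q => Id (Id A x z) (concat p (concat (inv p) q)) q) _ q).
rewrite concat_rfl.
refine (J (fun y p => Id (Id A x x) (concat p (inv p)) (rfl x)) _ p).
apply id_of_eq. rewrite inv_rfl. apply concat_rfl.
Qed.

(** Only a retraction is asked for, which is what makes the rest short: most
    maps used below are rearrangements of tuples whose round trip on one side
    is definitional. *)
Lemma isContr_retract X Y (s : Y -> X) (r : X -> Y)
    (h : forall y, Id Y (r (s y)) y) : isContr X -> isContr Y.
Proof.
intros [x k]. exists (r x). intro y.
exact (concat (ap r (k (s y))) (h y)).
Qed.

Definition contr_path X (c : isContr X) (x y : X) : Id X x y :=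
  concat (inv (projT2 c x)) (projT2 c y).

Lemma isContr_Id X (c : isContr X) (x y : X) : isContr (Id X x y).
Proof.
exists (contr_path c x y). intro p.
refine (J (fun y p => Id (Id X x y) (contr_path c x y) p) _ p).
apply concat_inv_l.
Qed.

Lemma isProp_isContr X : isContr X -> isProp X.
Proof. intro c. exact (contr_path c). Qed.

Lemma isContr_isProp X : isProp X -> X -> isContr X.
Proof. intros h x. exact (existT _ x (h x)). Qed.

Lemma isContr_Id_isProp X : isProp X -> forall x y : X, isContr (Id X x y).
Proof. intros h x. apply isContr_Id. exact (isContr_isProp h x). Qed.

Lemma isSet_isProp X : isProp X -> isSet X.
Proof. intros h x y. apply isProp_isContr. now apply isContr_Id_isProp. Qed.

Lemma isContr_Sigma X (B : X -> type T) :
  isContr X -> (forall x, isContr (B x)) -> isContr (Sigma B).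
Proof.
intros [x0 k] c. exists (existT _ x0 (projT1 (c x0))). intros [x y].
exact (J (fun x _ => Pi (fun y : B x =>
            Id (Sigma B) (existT _ x0 (projT1 (c x0))) (existT _ x y)))
         (fun y => ap (fun b => existT _ x0 b : Sigma B) (projT2 (c x0) y))
         (k x) y).
Qed.

(** A converse of [isContr_Sigma].  Transport along the path given by the
    contraction is a retraction of [Sigma B] onto [B x], because that path is
    trivial from [x] to itself. *)
Lemma isContr_fiber_Sigma X (B : X -> type T) :
  isContr X -> isContr (Sigma B) -> forall x, isContr (B x).
Proof.
intros c cS x.
refine (isContr_retract (s := fun y : B x => existT _ x y : Sigma B)
  (r := fun z : Sigma B => transport (contr_path c (projT1 z) x) (projT2 z))
  _ cS).
intro y; simpl.
refine (concat (ap (fun p => transport (B := B) p y)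
                  (concat_inv_l (projT2 c x))) _).
apply id_of_eq. apply transport_rfl.
Qed.

Lemma isContr_singleton X (x : X) : isContr (Sigma (fun y => Id X x y)).
Proof.
exists (existT _ x (rfl x)). intros [y p].
exact (J (fun y p => Id (Sigma (fun y => Id X x y))
            (existT _ x (rfl x)) (existT _ y p)) (rfl _) p).
Qed.

Lemma equiv_injective X Y (f : Arr X Y) (e : isEquiv f) (x x' : X) :
  Id Y (f x) (f x') -> Id X x x'.
Proof.
intro p.
exact (ap (fun z : fiber f (f x') => projT1 z)
  (contr_path (e (f x')) (existT _ x p) (existT _ x' (rfl _)))).
Qed.

Lemma isEquiv_homotopic_id X (k : Arr X X) :
  (forall x, Id X (k x) x) -> isEquiv k.
Proof.
intros h y.
refine (isContr_retract
  (s := fun z : fiber k y =>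
     existT _ (projT1 z) (concat (inv (h (projT1 z))) (projT2 z))
       : fiber (idmap X) y)
  (r := fun z : fiber (idmap X) y =>
     existT _ (projT1 z) (concat (h (projT1 z)) (projT2 z)) : fiber k y)
  _ (isEquiv_idmap X y)).
intros [x p]; simpl.
exact (ap (fun q => existT _ x q : fiber k y) (concat_inv_cancel (h x) p)).
Qed.

(** The fiber of [f] over [y] is a retract of the fiber of [g o f] over [g y]:
    apply [g] in one direction, and apply [f] and cancel [f o g] in the other.
    The round trip on paths is naturality of [fg]. *)
Lemma isEquiv_inverse X Y (f : Arr X Y) (g : Arr Y X) :
  (forall y, Id Y (f (g y)) y) -> (forall x, Id X (g (f x)) x) -> isEquiv f.
Proof.
intros fg gf y.
pose (k := (fun x => g (f x)) : Arr X X).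
refine (isContr_retract
  (s := fun z : fiber f y =>
     existT _ (projT1 z) (ap g (projT2 z)) : fiber k (g y))
  (r := fun z : fiber k (g y) =>
     existT _ (projT1 z)
       (concat (inv (fg (f (projT1 z)))) (concat (ap f (projT2 z)) (fg y)))
       : fiber f y)
  _ (isEquiv_homotopic_id gf (g y))).
intros [x p]; simpl.
refine (ap (fun q => existT _ x q : fiber f y) _).
refine (J (fun y p => Id (Id Y (f x) y)
  (concat (inv (fg (f x))) (concat (ap f (ap g p)) (fg y))) p) _ p).
assert (E : ap f (ap g (rfl (f x))) = rfl (f (g (f x)))).
{ rewrite ap_rfl. apply ap_rfl. }
rewrite E.
(* Only the path [fg (f x)] from [f (g (f x))] to [f x] is left, so its
   endpoint [f x] can be varied. *)
refine (J (fun w q => Id (Id Y w w)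
  (concat (inv q) (concat (rfl _) q)) (rfl w)) _ (fg (f x))).
apply id_of_eq. rewrite !concat_rfl. apply inv_rfl.
Qed.

Lemma isEquiv_isProp X Y : isProp X -> isProp Y ->
  forall f : Arr X Y, (Y -> X) -> isEquiv f.
Proof.
intros hX hY f g.
apply (isEquiv_inverse (g := g)); intro; [apply hY | apply hX].
Qed.

Lemma isProp_prod X Y : isProp X -> isProp Y -> isProp (Sigma (fun _ : X => Y)).
Proof.
intros hX hY x y. apply isProp_isContr. apply isContr_Sigma.
- exact (isContr_isProp hX (projT1 x)).
- intro. exact (isContr_isProp hY (projT2 x)).
Qed.

(** A reflexive propositional relation that implies identity makes the type a
    set.  [dec y] is corrected by the inverse of the value at [r x], so that it
    sends [r x] to the trivial path; thus [Id X x y] is a retract of the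
    proposition [R x y]. *)
Lemma isSet_relation X (R : X -> X -> type T) :
  (forall x y, isProp (R x y)) -> (forall x, R x x) ->
  (forall x y, R x y -> Id X x y) -> isSet X.
Proof.
intros hR r i x y.
pose (dec y (u : R x y) := concat (inv (i x x (r x))) (i x y u)).
assert (K : forall p : Id X x y,
          Id (Id X x y) (dec y (transport (B := R x) p (r x))) p).
{ intro p.
  refine (J (fun y p => Id (Id X x y) (dec y (transport (B := R x) p (r x))) p)
            _ p).
  rewrite transport_rfl. apply concat_inv_l. }
intros p q.
refine (concat (inv (K p)) (concat _ (K q))).
refine (ap (dec y) _). apply hR.
Qed.

Definition cast X Y (e : X = Y) (x : X) : Y :=
  match e in _ = Z return Z with eq_refl => x end.

Lemma cast_cast X Y (e : X = Y) (x : X) :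
  cast (eq_sym e) (cast e x) = x.
Proof. now destruct e. Qed.

Lemma isContr_Sigma_eq X (B B' : X -> type T) (e : forall x, B x = B' x) :
  isContr (Sigma B') -> isContr (Sigma B).
Proof.
refine (isContr_retract
  (s := fun z : Sigma B => existT _ (projT1 z) (cast (e _) (projT2 z))
          : Sigma B')
  (r := fun z : Sigma B' =>
     existT _ (projT1 z) (cast (eq_sym (e _)) (projT2 z)) : Sigma B) _).
intros [x b]; simpl. apply id_of_eq. now rewrite cast_cast.
Qed.

End Paths.

(** * Connected types *)

Section Truncation.
Context {T : type_theory} (S : set_truncation T).
Implicit Types X Y : type T.

Lemma isProp_Id_Trunc0 X (s t : Trunc0 S X) : isProp (Id (Trunc0 S X) s t).
Proof. apply isSet_Trunc0. Qed.

Definition Trunc0_map X Y (f : X -> Y) : Trunc0 S X -> Trunc0 S Y :=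
  Trunc0_ind (P := fun _ => Trunc0 S Y) (fun _ => @isSet_Trunc0 T S Y)
    (fun x => tr0 S (f x)).

Lemma Trunc0_map_tr0 X Y (f : X -> Y) (x : X) :
  Trunc0_map f (tr0 S x) = tr0 S (f x).
Proof. exact (Trunc0_ind_tr0 (fun _ => @isSet_Trunc0 T S Y) _ x). Qed.

Lemma connected_tr0 X Y (f : X -> Y) (c : connected S X) (x y : X) :
  Id (Trunc0 S Y) (tr0 S (f x)) (tr0 S (f y)).
Proof.
rewrite <- !Trunc0_map_tr0.
exact (ap (Trunc0_map f) (contr_path c (tr0 S x) (tr0 S y))).
Qed.

(** The base [tr0 S x] has to become a variable [t] for the path in a point of
    the component to be eliminated.  The centers [c t] come from induction on
    [t], as each [F t] is a set. *)
Lemma connected_component X (x : X) : connected S (component S x).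
Proof.
pose (G t := Sigma (fun x' : X => Id (Trunc0 S X) (tr0 S x') t)).
pose (F t := Trunc0 S (G t)).
pose (d := fun y : X =>
  tr0 S (existT _ y (rfl (tr0 S y)) : G (tr0 S y)) : F (tr0 S y)).
pose (c := Trunc0_ind (P := F) (fun t => @isSet_Trunc0 T S _) d).
assert (K : forall t (z : F t), Id (F t) (c t) z).
{ intro t. apply Trunc0_ind.
  - intro z. apply isSet_isProp, isProp_Id_Trunc0.
  - intros [y p].
    refine (J (fun t p => Id (F t) (c t) (tr0 S (existT _ y p : G t))) _ p).
    apply id_of_eq.
    exact (Trunc0_ind_tr0 (P := F) (fun t => @isSet_Trunc0 T S (G t)) d y). }
exact (existT _ (c (tr0 S x)) (K (tr0 S x))).
Qed.

Lemma connected_retract X Y (s : Y -> X) (r : X -> Y)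
    (h : forall y, Id Y (r (s y)) y) : connected S X -> connected S Y.
Proof.
apply (isContr_retract (s := Trunc0_map s) (r := Trunc0_map r)).
apply Trunc0_ind.
- intro. apply isSet_isProp, isProp_Id_Trunc0.
- intro y. rewrite !Trunc0_map_tr0. exact (ap (tr0 S (A := Y)) (h y)).
Qed.

End Truncation.

(** * Univalence, and the set of propositions of a universe *)

Section Universe.
Context {T : type_theory} {S : set_truncation T} (V : univalent_universe S).
Implicit Types X Y Z : type T.

(** Smallness up to outer equality rather than up to equivalence, so that [X]
    can be replaced by [El u] inside [Arr Z X], where univalence then acts by
    postcomposition. *)
Definition code X : Type := {u : U V & El u = X}.

Definition El_code (u : U V) : code (El u) := existT _ u eq_refl.

Lemma code_Arr X Y : code X -> code Y -> code (Arr X Y).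
Proof. intros [u []] [v []]. exact (existT _ _ (El_pi (fun _ => v))). Qed.

Lemma code_Sigma X (b : X -> U V) : code X -> code (Sigma (fun x => El (b x))).
Proof. intros [u e]. destruct e. exact (existT _ _ (El_sigma b)). Qed.

Lemma code_Id X (x y : X) : code X -> code (Id X x y).
Proof. intros [u e]. destruct e. exact (existT _ _ (El_Id x y)). Qed.

Lemma code_Trunc0 X : code X -> code (Trunc0 S X).
Proof. intros [u []]. exact (existT _ _ (El_Trunc0 u)). Qed.

(** Univalence makes every equivalence the image of a path, and the computation
    rule of [J] makes the identity equivalence the image of [rfl]. *)
Lemma equiv_induction (a : U V)
    (Q : forall b : U V, Equiv (El a) (El b) -> type T) :
  Q a (equiv_idmap (El a)) -> forall b e, Q b e.
Proof.
intros d b e.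
destruct (univalence e) as [[p q] _].
refine (transport (B := Q b) q _).
refine (J (fun b p => Q b (idtoequiv (El (u := V)) p)) _ p).
unfold idtoequiv. rewrite J_rfl. exact d.
Qed.

(** By [equiv_induction] the equivalence may be taken to be the identity, for
    which postcomposition is the identity too. *)
Lemma isEquiv_postcomp X Y (cX : code X) (cY : code Y) Z (w : Arr X Y) :
  isEquiv w ->
  isEquiv (fun h : Arr Z X => (fun z => w (h z)) : Arr Z Y).
Proof.
revert w. destruct cX as [u []], cY as [v []]. intros w e.
exact (equiv_induction
  (Q := fun v e => isEquiv (fun h : Arr Z (El u) =>
          (fun z => projT1 e (h z)) : Arr Z (El v)))
  (isEquiv_idmap (Arr Z (El u))) (existT _ w e)).
Qed.

(** Propositionality with the two projections of [X * X] equal as functions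
    rather than pointwise.  Any two functions into [X] are then equal, by
    composing with their pairing, and in particular this notion is itself a
    proposition ([isProp_uniform_prop]); the pointwise notion would need
    function extensionality for both. *)
Definition uniform_prop X : type T :=
  Id (Arr (Sigma (fun _ : X => X)) X)
    (fun z => projT1 z) (fun z => projT2 z).

Lemma uniform_prop_Arr Z X : uniform_prop X -> isProp (Arr Z X).
Proof.
intros h f g.
exact (ap (fun k : Arr (Sigma (fun _ : X => X)) X =>
             (fun z => k (existT _ (f z) (g z))) : Arr Z X) h).
Qed.

Lemma uniform_prop_isProp X : uniform_prop X -> isProp X.
Proof.
intros h x y.
exact (ap (fun k : Arr (Sigma (fun _ : X => X)) X => k (existT _ x y)) h).
Qed.

Lemma isProp_uniform_prop X : isProp (uniform_prop X).
Proof.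
intros h. apply isSet_isProp. now apply uniform_prop_Arr.
Qed.

(** The first projection of [X * X] is an equivalence, so postcomposition with
    it is injective on functions.  It sends both the identity and
    [fun z => (fst z, fst z)] to itself, so these two agree, and applying the
    second projection to them gives the claim. *)
Lemma uniform_prop_El (u : U V) : isProp (El u) -> uniform_prop (El u).
Proof.
intro h. set (X := El u) in *.
pose (XX := Sigma (fun _ : X => X)).
pose (fst := (fun z => projT1 z) : Arr XX X).
pose (diag := (fun x => existT _ x x) : Arr X XX).
assert (e : isEquiv fst).
{ apply isEquiv_isProp; [now apply isProp_prod | exact h | exact diag]. }
assert (p : Id (Arr XX XX) (fun z => diag (fst z)) (idmap XX)).
{ apply (equiv_injective
    (isEquiv_postcomp (code_Sigma (fun _ => u) (El_code u)) (El_code u)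
       (Z := XX) e)).
  exact (rfl fst). }
exact (ap (fun k : Arr XX XX => (fun z => projT2 (k z)) : Arr XX X) p).
Qed.

Definition hProp : type T := Sigma (fun u : U V => uniform_prop (El u)).

(** Logical equivalence is a reflexive propositional relation, and univalence
    turns it into identity. *)
Lemma isSet_hProp : isSet hProp.
Proof.
apply (isSet_relation (R := fun P Q : hProp =>
  Sigma (fun _ : Arr (El (projT1 P)) (El (projT1 Q)) =>
         Arr (El (projT1 Q)) (El (projT1 P))))).
- intros [u h] [v k]. apply isProp_prod; now apply uniform_prop_Arr.
- intro P. exact (existT _ (fun x => x) (fun x => x)).
- intros [u h] [v k] [f g].
  assert (e : isEquiv (f : Arr (El u) (El v))).
  { apply isEquiv_isProp; [now apply uniform_prop_isProp .. | exact g]. }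
  refine (equiv_induction
    (Q := fun v _ => Pi (fun k : uniform_prop (El v) =>
             Id hProp (existT _ u h) (existT _ v k)))
    _ (existT _ f e) k).
  intro k'. refine (ap (fun k => existT _ u k : hProp) _).
  apply isProp_uniform_prop.
Qed.

(** The family [P] factors through the set truncation of [X], because it takes
    values in the set [hProp]; there the points [x0] and [x] become equal. *)
Lemma connected_ind X (c : connected S X) (P : X -> U V) (x0 : X) :
  (forall x, isProp (El (P x))) -> El (P x0) -> forall x, El (P x).
Proof.
intros hP d x.
pose (f := fun x => existT _ (P x) (uniform_prop_El (hP x)) : hProp).
pose (F := Trunc0_ind (P := fun _ : Trunc0 S X => hProp)
             (fun _ => isSet_hProp) f).
assert (E : forall x, F (tr0 S x) = f x).
{ exact (Trunc0_ind_tr0 (fun _ => isSet_hProp) f). }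
change (El (projT1 (f x))). rewrite <- E.
refine (transport (B := fun t => El (projT1 (F t)))
          (contr_path c (tr0 S x0) (tr0 S x)) _).
rewrite E. exact d.
Qed.

End Universe.

(** * H-space structures on a central type *)

Section CentralType.
Context {T : type_theory} {S : set_truncation T} {V : univalent_universe S}.
Context {A : pointed V} (cA : central A).

Notation AA := (Arr A A).
Notation in_id_component f :=
  (Id (Trunc0 S AA) (tr0 S (A := AA) f) (tr0 S (A := AA) (idmap A))).

Lemma central_connected : connected S A.
Proof.
refine (connected_retract (r := ev (A := A))
  (s := fun a => projT1 (projT1 (cA a))) _ (connected_component S _)).
intro a. exact (projT2 (projT1 (cA a))).
Qed.

Lemma central_injective (f : AA) :
  in_id_component f -> Id A (f (pt A)) (pt A) -> Id AA f (idmap A).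
Proof.
intros l p.
refine (ap (fun c : component S (idmap A) => projT1 c)
  (equiv_injective cA (x := existT _ f l) (x' := existT _ (idmap A) (rfl _)) p)).
Qed.

(** The fibers of [ap ev] on paths to the identity, where [ev] is an
    equivalence.  Let [f], [l] and [q] vary: they then range over the fiber [B]
    of [ev] over the base point, which is contractible.  The total space of
    [F] over [B] is also contractible, by contracting [f] along [p] to the
    identity and [q] along the coherence.  So each [F b] is contractible. *)
Lemma central_isContr_fiber_ap_ev (f : AA) (l : in_id_component f)
    (q : Id A (f (pt A)) (pt A)) :
  isContr (Sigma (fun p : Id AA f (idmap A) =>
    Id (Id A (f (pt A)) (pt A)) (happly p (pt A)) q)).
Proof.
pose (B := fiber (ev (A := A)) (pt A)).
pose (F := fun b : B => Sigma (fun p : Id AA (projT1 (projT1 b)) (idmap A) =>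
    Id (Id A (projT1 (projT1 b) (pt A)) (pt A)) (happly p (pt A)) (projT2 b))).
change (isContr (F (existT _ (existT _ f l) q))).
apply isContr_fiber_Sigma; [apply cA |].
pose (W := Sigma (fun y : fiber (idmap AA) (idmap A) =>
  Sigma (fun _ : in_id_component (projT1 y) =>
  Sigma (fun q : Id A (projT1 y (pt A)) (pt A) =>
    Id (Id A (projT1 y (pt A)) (pt A)) (happly (projT2 y) (pt A)) q)))).
refine (isContr_retract (X := W)
  (s := fun z : Sigma F =>
    match z with existT _ (existT _ (existT _ g k) r) (existT _ p h) =>
      existT _ (existT _ g p) (existT _ k (existT _ r h)) : W
    end)
  (r := fun w : W =>
    match w with existT _ (existT _ g p) (existT _ k (existT _ r h)) =>
      existT _ (existT _ (existT _ g k) r) (existT _ p h) : Sigma F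
    end)
  _ _).
- intros [[[g k] r] [p h]]. apply rfl.
- apply isContr_Sigma; [exact (isEquiv_idmap AA (idmap A)) |].
  intros [g p]. apply isContr_Sigma.
  + apply isContr_isProp; [apply isProp_Id_Trunc0 | exact (ap (tr0 S (A := AA)) p)].
  + intro. apply isContr_singleton.
Qed.

Lemma connected_in_component (c : connected S A) (mu : Arr A AA)
    (mul : Id AA (mu (pt A)) (idmap A)) (a : A) : in_id_component (mu a).
Proof.
exact (concat (connected_tr0 (Y := AA) mu c a (pt A)) (ap (tr0 S (A := AA)) mul)).
Qed.

Definition in_component_code (f : AA) : code V (in_id_component f) :=
  code_Id (tr0 S f) (tr0 S (idmap A))
    (code_Trunc0 (code_Arr (El_code (carrier A)) (El_code (carrier A)))).

(** The component of the identity, with its membership condition written as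
    [El] of a family of codes, so that the whole type has a code. *)
Definition coded_component : type T :=
  Sigma (fun f : AA => El (projT1 (in_component_code f))).

Definition coded_ev : Arr coded_component A := fun c => projT1 c (pt A).

Lemma isEquiv_coded_ev : isEquiv coded_ev.
Proof.
intro a.
refine (isContr_retract
  (s := fun z : fiber coded_ev a =>
    match z with existT _ (existT _ f l) p =>
      existT _ (existT _ f (cast (projT2 (in_component_code f)) l)) p
        : fiber (ev (A := A)) a
    end)
  (r := fun z : fiber (ev (A := A)) a =>
    match z with existT _ (existT _ f l) p =>
      existT _ (existT _ f (cast (eq_sym (projT2 (in_component_code f))) l)) p
        : fiber coded_ev a
    end)
  _ (cA a)).
intros [[f l] p]; simpl. apply id_of_eq.
now rewrite cast_cast.
Qed.

(** Sections of [coded_ev], with the map [A -> coded_component] split into its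
    two components. *)
Definition ev_section : type T :=
  Sigma (fun mu : Arr A AA =>
  Sigma (fun _ : Id AA (fun a => mu a (pt A)) (idmap A) =>
    Pi (fun a => El (projT1 (in_component_code (mu a)))))).

Lemma central_isContr_ev_section : isContr ev_section.
Proof.
pose (post := (fun h => (fun a => coded_ev (h a)))
                : Arr (Arr A coded_component) AA).
assert (e : isEquiv post).
{ apply (isEquiv_postcomp (V := V)).
  - apply code_Sigma, code_Arr; apply El_code.
  - apply El_code.
  - exact isEquiv_coded_ev. }
refine (isContr_retract
  (s := fun s : ev_section =>
    match s with existT _ mu (existT _ mur l) =>
      existT _ (fun a => existT _ (mu a) (l a) : coded_component) mur
        : fiber post (idmap A)
    end)
  (r := fun z : fiber post (idmap A) =>
    existT _ (fun a => projT1 (projT1 z a))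
      (existT _ (projT2 z) (fun a => projT2 (projT1 z a))) : ev_section)
  _ (e (idmap A))).
intros [mu [mur l]]. apply rfl.
Qed.

(** [HSpace A] is a retract of the type [W] of a section of [ev] and the path
    and coherence over it.  An H-space determines that its maps lie in the
    component of the identity, and the retraction forgets this again. *)
Lemma central_isContr_HSpace : isContr (HSpace A).
Proof.
pose (W := Sigma (fun s : ev_section =>
  Sigma (fun p : Id AA (projT1 s (pt A)) (idmap A) =>
    Id (Id A (projT1 s (pt A) (pt A)) (pt A))
      (happly p (pt A)) (happly (projT1 (projT2 s)) (pt A))))).
refine (isContr_retract (X := W)
  (s := fun m : HSpace A =>
    match m with existT _ mu (existT _ mul (existT _ mur h)) =>
      existT _ (existT _ mu (existT _ mur (fun a =>
          cast (eq_sym (projT2 (in_component_code (mu a))))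
            (connected_in_component central_connected mul a))))
        (existT _ mul h) : W
    end)
  (r := fun w : W =>
    match w with existT _ (existT _ mu (existT _ mur l)) (existT _ mul h) =>
      existT _ mu (existT _ mul (existT _ mur h)) : HSpace A
    end)
  _ _).
- intros [mu [mul [mur h]]]. apply rfl.
- apply isContr_Sigma; [exact central_isContr_ev_section |].
  intros [mu [mur l]]. apply central_isContr_fiber_ap_ev.
  exact (cast (projT2 (in_component_code _)) (l (pt A))).
Qed.

Definition opposite (m : HSpace A) : HSpace A :=
  existT _ (fun a b => projT1 m b a)
    (existT _ (projT1 (projT2 (projT2 m)))
    (existT _ (projT1 (projT2 m)) (inv (projT2 (projT2 (projT2 m)))))).

Lemma central_op_comm (m : HSpace A) (a b : A) : Id A (op m a b) (op m b a).
Proof.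
exact (ap (fun m => op m a b : A)
  (contr_path central_isContr_HSpace m (opposite m))).
Qed.

Lemma op_pt_l (m : HSpace A) (x : A) : Id A (op m (pt A) x) x.
Proof. exact (happly (projT1 (projT2 m)) x). Qed.

Lemma op_pt_r (m : HSpace A) (x : A) : Id A (op m x (pt A)) x.
Proof. exact (happly (projT1 (projT2 (projT2 m))) x). Qed.

(** The composite fixes the base point, and it is in the component of the
    identity: by connectedness, [a] can first be replaced by the base point, and
    then [mu b] is left. *)
Lemma central_op_inverse (m : HSpace A) (a b : A) :
  Id A (op m a b) (pt A) -> forall x, Id A (op m a (op m b x)) x.
Proof.
intros p x.
refine (happly (g := idmap A) (f := fun x => op m a (op m b x)) _ x).
apply central_injective.
- refine (concat (connected_tr0 (Y := AA)
    (fun a => (fun x => op m a (op m b x)) : AA) central_connected a (pt A)) _).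
  refine (concat (ap (fun f : AA => tr0 S ((fun x => f (op m b x)) : AA))
     (projT1 (projT2 m))) _).
  exact (connected_in_component central_connected (projT1 (projT2 m)) b).
- exact (concat (ap (fun y => op m a y : A) (op_pt_r m b)) p).
Qed.

Lemma central_isEquiv_op (m : HSpace A) (a b : A) :
  Id A (op m a b) (pt A) -> isEquiv (fun x : A => op m a x : A).
Proof.
intro p. apply (isEquiv_inverse (g := fun x : A => op m b x : A)).
- now apply central_op_inverse.
- apply central_op_inverse. exact (concat (central_op_comm m b a) p).
Qed.

(** The proposition proved by induction on the connected type [A] is the fiber
    of [mu a] over the base point, in coded form: a point of it makes [mu a] an
    equivalence, and hence the fiber itself contractible. *)
Lemma central_left_invertible (m : HSpace A) : left_invertible m.
Proof.
pose (cId a b := code_Id (op m a b) (pt A) (El_code (carrier A))).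
pose (F a := Sigma (fun b : A => El (projT1 (cId a b)))).
pose (cF a := code_Sigma (fun b : A => projT1 (cId a b)) (El_code (carrier A))
               : code V (F a)).
assert (K : forall a, F a -> isEquiv (fun x : A => op m a x : A)).
{ intros a z. apply (central_isEquiv_op (b := projT1 z)).
  exact (cast (projT2 (cId a _)) (projT2 z)). }
assert (D : forall a, El (projT1 (cF a))).
{ apply (connected_ind central_connected (x0 := pt A)).
  - intro a. rewrite (projT2 (cF a)). intro z.
    refine (contr_path (X := F a) _ z).
    apply (isContr_Sigma_eq (fun b => projT2 (cId a b))).
    exact (K a z (pt A)).
  - rewrite (projT2 (cF (pt A))). exists (pt A).
    exact (cast (eq_sym (projT2 (cId _ _))) (op_pt_l m (pt A))). }
intro a. exact (K a (cast (projT2 (cF a)) (D a))).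
Qed.

Lemma central_right_invertible (m : HSpace A) : right_invertible m.
Proof.
exact (central_left_invertible (opposite m)).
Qed.

End CentralType.

Theorem proposition3p3 (T : type_theory) (S : set_truncation T)
    (V : univalent_universe S) (A : pointed V) :
  central A ->
  isContr (HSpace A) *
  connected S A *
  (forall m : HSpace A, left_invertible m * right_invertible m).
Proof.
intro cA. split; [split |].
- now apply central_isContr_HSpace.
- now apply central_connected.
- intro m. split; [now apply central_left_invertible |].
  now apply central_right_invertible.
Qed.
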